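(* Let $X$ be a metric space, $x\in X$, $0<\alpha<1$, $0<r<R$, $k\in\mathbb{N}$. Suppose that $B_R(x)$ satisfies the doubling condition with constant $\lambda\in\mathbb{N}$ and that for every $y\in B_R(x)$ the ball $B_r(y)$ is free of $k$-point $\mathrm{SRA}(\alpha)$ subspaces. Then $B_R(x)$ is free of $k\lambda^{\lceil\log_2(R/r)\rceil}$-point $\mathrm{SRA}(\alpha)$ subspaces, where $\lceil\cdot\rceil$ denotes rounding up to an integer.
   Context: $B_r(x)$ denotes the open ball, regarded as a metric space with the metric induced from $X$. A metric space satisfies the doubling condition with constant $\lambda\in\mathbb{N}$ if, for every $\rho>0$, every ball of radius $\rho$ in it can be covered by at most $\lambda$ balls (in this metric space) of radius $\rho/2$. For $0<\alpha<1$, a metric space $(Y,d)$ satisfies the $\mathrm{SRA}(\alpha)$ condition if for all $x,y,z\in Y$, $d(x,y)\le\max\{d(x,z)+\alpha d(z,y),\ \alpha d(x,z)+d(z,y)\}$. For $k\in\mathbb{N}$, a metric space is free of $k$-point $\mathrm{SRA}(\alpha)$ subspaces if no $k$-point subset of it (with the induced metric) satisfies the $\mathrm{SRA}(\alpha)$ condition. *)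

(* Defs.v *)
From mathcomp Require Import all_boot all_order all_algebra.
From mathcomp Require Import all_classical all_reals all_analysis.

Set Implicit Arguments.
Unset Strict Implicit.
Unset Printing Implicit Defensive.

Import Order.TTheory GRing.Theory Num.Theory.

Local Open Scope classical_set_scope.
Local Open Scope ring_scope.

Section MetricSubspaces.
Context {K : realType} {X : metricType K}.

(* A set [A : set X] stands for the metric space [A] with the induced metric.
   Its balls are the sets [A `&` ball c rho] with centre [c] in [A]. *)
Definition subspace_ball (A : set X) (c : X) (rho : K) : set X :=
  A `&` ball c rho.

Definition doubling (A : set X) (lambda : nat) : Prop :=
  forall (rho : K) (c : X), 0 < rho -> A c ->
    exists C : seq X,
      [/\ (size C <= lambda)%N,
          (forall c', c' \in C -> A c') &
          subspace_ball A c rho `<=`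
            \bigcup_(c' in [set` C]) subspace_ball A c' (rho / 2)].

Definition SRA (alpha : K) (S : set X) : Prop :=
  forall x y z, S x -> S y -> S z ->
    mdist x y <= Num.max (mdist x z + alpha * mdist z y)
                         (alpha * mdist x z + mdist z y).

Definition SRA_free (alpha : K) (k : nat) (A : set X) : Prop :=
  forall S : set X, S `<=` A -> (S #= `I_k)%card -> ~ SRA alpha S.

End MetricSubspaces.

Definition log2 {K : realType} (a : K) : K := ln a / ln 2.

(* Main.v *)
(* Iterating the doubling condition n times covers the ball of radius R by
   lambda^n balls of radius R / 2^n, and R / 2^n <= r for
   n = ceil (log2 (R / r)).  By pigeonhole, one of them contains k of any
   k * lambda^n points, and the SRA condition passes to subsets. *)
Require Import Defs.
From mathcomp Require Import all_boot all_order all_algebra finmap.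
From mathcomp Require Import all_classical all_reals all_analysis.

Import Order.TTheory GRing.Theory Num.Theory.

Local Open Scope classical_set_scope.
Local Open Scope ring_scope.

Lemma card_set_seq (T : eqType) (s : seq T) :
  uniq s -> ([set` s] #= `I_(size s))%card.
Proof.
elim: s => [_|a s IH /= /andP[as_ us]].
  by rewrite II0 (_ : [set` [::]] = set0) //; apply/seteqP; split.
apply/eq_cardSP; exists a; first by rewrite /= mem_head.
rewrite (_ : [set` a :: s] `\ a = [set` s]); first exact: IH.
apply/seteqP; split => y /=.
  by case; rewrite in_cons => /orP[/eqP//|].
move=> ys; split; first by rewrite in_cons ys orbT.
by move=> ya; move: as_; rewrite -ya ys.
Qed.

(** Union bound in counting form: each entry of [s] adds at least one to the right-hand side,
    through some [c] with [P c a]. *)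
Lemma size_le_sum_count (I T : eqType) (C : seq I) (P : I -> pred T)
    (s : seq T) :
  {in s, forall a, exists2 c, c \in C & P c a} ->
  (size s <= \sum_(c <- C) count (P c) s)%N.
Proof.
elim: s => [|a s IH] cov //=.
rewrite big_split /= -add1n; apply: leq_add; last first.
  by apply: IH => b bs; apply: cov; rewrite in_cons bs orbT.
have [|c cC Pca] := cov a; first exact: mem_head.
by rewrite (big_rem c) //= Pca.
Qed.

(** If every [B c] held at most [k.-1] points of [S], then [S] would have at most [k.-1 * L] points,
    fewer than [k * L] since [k] and [L] are positive. *)
Lemma pigeonhole_cover (I T : choiceType) (C : seq I) (B : I -> set T)
    (S : set T) (k L : nat) :
  (0 < k)%N -> (0 < L)%N -> (size C <= L)%N -> (S #= `I_(k * L))%card ->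
  S `<=` \bigcup_(c in [set` C]) B c ->
  exists c T', [/\ c \in C, T' `<=` S `&` B c & (T' #= `I_k)%card].
Proof.
move=> k_gt0 L_gt0 CL Scard Scov.
have Sfin : finite_set S by apply/finite_setP; exists (k * L)%N.
pose s : seq T := fset_set S.
have sS a : a \in s -> S a by rewrite in_fset_set // inE.
have ss : size s = (k * L)%N := card_fset_set Scard.
pose P c : pred T := fun a => `[< B c a >].
have [/hasP[c cC kc]|/hasPn few] :=
    boolP (has (fun c => k <= count (P c) s)%N C).
  (* [B c] may hold more than [k] points of [S]; [take] trims them to exactly [k], as [SRA_free]
     requires. *)
  exists c, [set` take k (seq.filter (P c) s)]; split=> //.
    move=> a /= /mem_take; rewrite mem_filter => /andP[/asboolP Bca as_].
    by split=> //; exact: sS.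
  rewrite -{2}(_ : size (take k (seq.filter (P c) s)) = k).
    by apply: card_set_seq; rewrite take_uniq // filter_uniq // fset_uniq.
  by rewrite size_takel // size_filter.
have : (size s <= \sum_(c <- C) count (P c) s)%N.
  apply: size_le_sum_count => a /sS /Scov[c /= cC Bca].
  by exists c => //; apply/asboolP.
have : (\sum_(c <- C) count (P c) s <= k.-1 * L)%N.
  apply: (@leq_trans (\sum_(c <- C) k.-1)%N).
    rewrite big_seq [X in (_ <= X)%N]big_seq; apply: leq_sum => c /few.
    by rewrite -ltnNge -{1}(prednK k_gt0) ltnS.
  by rewrite big_const_seq count_predT iter_addn_0 leq_mul2l CL orbT.
move=> h1 h2; have := leq_trans h2 h1.
by rewrite ss leq_mul2r -[X in (X <= _)%N](prednK k_gt0) ltnn orbF eqn0Ngt L_gt0.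
Qed.

Section Covering.
Context {K : realType} {X : metricType K}.

(** Induction with [rho] and [c] general: halve the radius once, then apply the hypothesis to each
    half-size ball. This is possible because the new centres stay in [A]. *)
Lemma doubling_iter (A : set X) (lambda n : nat) (rho : K) (c : X) :
  doubling A lambda -> 0 < rho -> A c ->
  exists C : seq X,
    [/\ (size C <= lambda ^ n)%N, (forall c', c' \in C -> A c') &
        Defs.subspace_ball A c rho `<=`
          \bigcup_(c' in [set` C]) Defs.subspace_ball A c' (rho / 2 ^+ n)].
Proof.
move=> dA; elim: n rho c => [|n IH] rho c rho_gt0 Ac.
  exists [:: c]; split=> // [c'|a aB]; first by rewrite inE => /eqP ->.
  by exists c; rewrite /= ?mem_head // expr0 divr1.
have [C [sC CA Ccov]] := dA rho c rho_gt0 Ac.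
have rho2_gt0 : 0 < rho / 2 by rewrite divr_gt0.
(* The premise [c' \in C] sits under the existential so that choice yields a cover for every point;
   off [C] it is the dummy [[::]]. *)
have /(_ _)/cid F : forall c', exists D : seq X, c' \in C ->
    [/\ (size D <= lambda ^ n)%N, (forall d, d \in D -> A d) &
        Defs.subspace_ball A c' (rho / 2) `<=`
          \bigcup_(d in [set` D]) Defs.subspace_ball A d (rho / 2 ^+ n.+1)].
  move=> c'; have [c'C|] := boolP (c' \in C); last by exists [::].
  have [D] := IH _ _ rho2_gt0 (CA _ c'C).
  by exists D; rewrite exprS invfM mulrA.
exists (flatten [seq projT1 (F c') | c' <- C]); split.
- rewrite size_flatten /shape -map_comp sumnE big_map expnS.
  apply: (@leq_trans (\sum_(c' <- C) lambda ^ n)%N).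
    by rewrite !big_seq; apply: leq_sum => c' /(projT2 (F c'))[].
  by rewrite big_const_seq count_predT iter_addn_0 mulnC leq_mul2r sC orbT.
- by move=> d /flattenP[_ /mapP[c' c'C ->]]; case: (projT2 (F c') c'C) => _ + _; exact.
- move=> a /Ccov[c' /= c'C]; case: (projT2 (F c') c'C) => _ _ /[apply] -[d /= dD ad].
  by exists d => //=; apply/flattenP; exists (projT1 (F c')) => //; exact: map_f.
Qed.

Lemma sub_SRA (alpha : K) (S T : set X) : T `<=` S -> SRA alpha S -> SRA alpha T.
Proof. by move=> TS SS a b c /TS Sa /TS Sb /TS Sc; exact: SS. Qed.

End Covering.

Lemma div_exp2_ceil_log2 (K : realType) (r R : K) :
  0 < r -> 0 < R -> R / 2 ^+ `|Num.ceil (log2 (R / r))| <= r.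
Proof.
move=> r_gt0 R_gt0; set n := `|_|%N.
have two_gt0 : (0 : K) < 2 ^+ n by rewrite exprn_gt0.
rewrite ler_pdivrMr // [r * _]mulrC -ler_pdivrMr //.
rewrite -ler_ln ?posrE ?divr_gt0 // lnXn // -[ln 2 *+ n]mulr_natl.
rewrite -ler_pdivrMr ?ln_gt0 ?ltr1n //.
(* After taking logarithms the goal is [log2 (R / r) <= n]; the absolute value can only enlarge the
   ceiling. *)
apply: le_trans (ceil_ge _) _; rewrite -/(log2 _).
by rewrite /n natr_absz ler_int ler_norm.
Qed.

(* [Num.ceil] is [int]-valued; since r < R the ceiling is positive, so the
   absolute value only casts it to [nat]. *)
Theorem theorem6 (K : realType) (X : metricType K) (x : X)
    (alpha r R : K) (k lambda : nat) :
  0 < alpha -> alpha < 1 ->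
  0 < r -> r < R ->
  doubling (ball x R) lambda ->
  (forall y : X, ball x R y -> SRA_free alpha k (ball y r)) ->
  SRA_free alpha (k * lambda ^ `|Num.ceil (log2 (R / r))|)%N (ball x R).
Proof.
move=> _ _ r_gt0 rR dbl free S SB Scard SS; set n := `|_|%N in Scard.
have R_gt0 : 0 < R := lt_trans r_gt0 rR.
have xB : ball x R x := ballxx x R_gt0.
(* For [k = 0] the empty set would be a 0-point SRA subspace of [ball x r], against [free]. *)
have k_gt0 : (0 < k)%N.
  case: k free Scard => [|//] /(_ x xB set0) free _.
  by exfalso; apply: free; rewrite ?II0 // => ? ? ? [].
(* A cover of a ball containing [x] has at least one member. *)
have lambda_gt0 : (0 < lambda)%N.
  have [C [sC _ /(_ x)]] := dbl R x R_gt0 xB.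
  by case=> // c cC _; apply: leq_trans sC; case: C cC.
have [C [sC CB Ccov]] := @doubling_iter _ _ _ _ n _ _ dbl R_gt0 xB.
(* [SB] is used twice because the covered set is [ball x R] intersected with itself: ambient space
   and ball coincide. *)
have [|c [T [cC TSB Tk]]] := @pigeonhole_cover _ _ C _ S k _ k_gt0 _ sC Scard
    (subset_trans (fun a Sa => conj (SB a Sa) (SB a Sa)) Ccov).
  by rewrite expn_gt0 lambda_gt0.
apply: (free c (CB c cC) T _ Tk).
  move=> a /TSB[_ [_]]; apply: le_ball; exact: div_exp2_ceil_log2.
by apply: sub_SRA SS => a /TSB[].
Qed.
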